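(* Let $K$ be a countable field (for example $K=\mathbb{Z}_2$, the field with two elements). Then there are at least $2^{\aleph_0}$ pairwise non-isomorphic simple left $MC_2(K)$-modules.
   Context: $M_m(R)$ is the ring of $m\times m$ matrices over $R$. Identify $M_2(M_{2^k}(R))$ with $M_{2^{k+1}}(R)$ via block matrices. The $2$-matricial closure $MC_2(R)$ of a ring $R$ is the direct limit of the rings $M_{2^k}(R)$, $k\in\mathbb{N}=\{0,1,2,\dots\}$ (with $M_{2^0}(R)=R$), along the injective ring morphisms $M_{2^k}(R)\to M_{2^{k+1}}(R)$ sending $A$ to the block diagonal matrix with $2$ diagonal blocks equal to $A$. *)

(* Defs.v *)
From HB Require Import structures.
From mathcomp Require Import all_boot all_algebra.
From mathcomp Require Import boolp classical_sets cardinality.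

Set Implicit Arguments.
Unset Strict Implicit.
Unset Printing Implicit Defensive.

Import GRing.Theory.
Local Open Scope quotient_scope.
Local Open Scope ring_scope.

Section MatricialClosure.
Variable R : pzRingType.

Lemma exp2S k : (2 ^ k + 2 ^ k = 2 ^ k.+1)%N.
Proof. by rewrite addnn -mul2n -expnS. Qed.

Definition dblmx k (A : 'M[R]_(2 ^ k)) : 'M[R]_(2 ^ k.+1) :=
  castmx (exp2S k, exp2S k) (block_mx A 0 0 A).

Lemma dblmx_inj k : injective (@dblmx k).
Proof.
move=> A B /(congr1 (castmx (esym (exp2S k), esym (exp2S k)))).
by rewrite !castmxK => /eq_block_mx[].
Qed.

Lemma dblmxB k : {morph @dblmx k : A B / A - B}.
Proof.
move=> A B; rewrite /dblmx; case: _ / (exp2S k); rewrite !castmx_id.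
by rewrite opp_block_mx add_block_mx !subr0.
Qed.

Lemma dblmxM k : {morph @dblmx k : A B / A *m B}.
Proof.
move=> A B; rewrite /dblmx; case: _ / (exp2S k); rewrite !castmx_id.
by rewrite mulmx_block !mulmx0 !mul0mx !addr0 !add0r.
Qed.

Lemma dblmx1 k : dblmx 1%:M = 1%:M :> 'M_(2 ^ k.+1).
Proof.
by rewrite /dblmx; case: _ / (exp2S k); rewrite castmx_id -scalar_mx_block.
Qed.

Lemma dblmx0 k : dblmx 0 = 0 :> 'M_(2 ^ k.+1).
Proof. by rewrite -(subr0 0) dblmxB subrr. Qed.

Lemma dblmxN k : {morph @dblmx k : A / - A}.
Proof. by move=> A; rewrite -sub0r dblmxB dblmx0 sub0r. Qed.

Lemma dblmxD k : {morph @dblmx k : A B / A + B}.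
Proof. by move=> A B; rewrite -{1}(opprK B) dblmxB dblmxN opprK. Qed.

(* The disjoint union of the rings M_{2^k}(R). *)
Definition MC2_pre := {k : nat & 'M[R]_(2 ^ k)}.
Definition lvl k (A : 'M[R]_(2 ^ k)) : MC2_pre :=
  Tagged (fun k => 'M[R]_(2 ^ k)) A.

(* The image of x in M_{2^n}(R) when tag x <= n (and 0 otherwise). *)
Fixpoint stage n (x : MC2_pre) : 'M[R]_(2 ^ n) :=
  if tag x == n then tagged_as (lvl (0 : 'M_(2 ^ n))) x
  else if n is m.+1 then dblmx (stage m x) else 0.

Lemma stage_lvl k (A : 'M[R]_(2 ^ k)) : stage k (lvl A) = A.
Proof. by case: k A => [|k] A; rewrite /= ?eqxx tagged_asE. Qed.

Lemma stageS n x : (tag x <= n)%N -> stage n.+1 x = dblmx (stage n x).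
Proof. by rewrite -ltnS => lt; rewrite [LHS]/= ltn_eqF. Qed.

Lemma stage_trans m n x :
  (tag x <= m <= n)%N -> stage n (lvl (stage m x)) = stage n x.
Proof.
case/andP=> xm; elim: n => [|n IHn].
  by rewrite leqn0 => /eqP m0; move: xm; rewrite m0 stage_lvl.
rewrite leq_eqVlt => /predU1P[<-|]; first by rewrite stage_lvl.
by rewrite ltnS => mn; rewrite !stageS ?IHn // (leq_trans xm).
Qed.

Definition MC2_eqv (x y : MC2_pre) : bool :=
  stage (maxn (tag x) (tag y)) x == stage (maxn (tag x) (tag y)) y.

(* The maps being injective, equality of images may be tested at any stage. *)
Lemma MC2_eqvE n x y : (tag x <= n)%N -> (tag y <= n)%N ->
  MC2_eqv x y = (stage n x == stage n y).
Proof.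
rewrite /MC2_eqv; set m := maxn _ _ => xn yn.
have mn : (m <= n)%N by rewrite geq_max xn.
have [xm ym] : (tag x <= m)%N /\ (tag y <= m)%N by rewrite leq_maxl leq_maxr.
elim: n mn {xn yn} => [|n IHn]; first by rewrite leqn0 => /eqP->.
rewrite leq_eqVlt => /predU1P[<- //|]; rewrite ltnS => mn.
rewrite !stageS ?(leq_trans _ mn) // IHn //.
by rewrite (inj_eq (@dblmx_inj n)).
Qed.

Lemma MC2_eqv_equiv : equiv_class_of MC2_eqv.
Proof.
split=> [x|x y|y x z]; first by rewrite /MC2_eqv.
  by rewrite /MC2_eqv maxnC eq_sym.
pose n := maxn (tag x) (maxn (tag y) (tag z)).
have [xn yn zn] : [/\ tag x <= n, tag y <= n & tag z <= n]%N.
  by rewrite /n !leq_max !leqnn !orbT.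
by rewrite !(@MC2_eqvE n) // => /eqP-> /eqP->.
Qed.

Canonical MC2_equiv := EquivRelPack MC2_eqv_equiv.

Definition MC2 := {eq_quot MC2_equiv}.
HB.instance Definition _ := Choice.on MC2.

(* The canonical maps M_{2^k}(R) -> MC_2(R). *)
Definition MC2_in k (A : 'M[R]_(2 ^ k)) : MC2 := \pi_MC2 (lvl A).

Lemma MC2_in_inj k : injective (@MC2_in k).
Proof.
move=> A B /eqmodP /=; rewrite (@MC2_eqvE k) //= => /eqP.
by rewrite !stage_lvl.
Qed.

Lemma MC2_in_dbl k (A : 'M[R]_(2 ^ k)) : MC2_in (dblmx A) = MC2_in A.
Proof.
apply/eqmodP => /=; rewrite (@MC2_eqvE k.+1) //.
by rewrite stage_lvl stageS // stage_lvl.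
Qed.

Lemma MC2_in_stage n x : (tag x <= n)%N -> MC2_in (stage n x) = \pi_MC2 x.
Proof.
move=> xn; apply/eqmodP => /=; rewrite (@MC2_eqvE n) //=.
by rewrite stage_lvl.
Qed.

Lemma MC2_in_surj n (a : MC2) :
  (tag (repr a) <= n)%N -> exists A : 'M[R]_(2 ^ n), a = MC2_in A.
Proof. by move=> an; exists (stage n (repr a)); rewrite MC2_in_stage ?reprK. Qed.

(* Sum and product are computed at a common stage. *)
Definition MC2_op2 (op : forall n, 'M[R]_(2 ^ n) -> 'M_(2 ^ n) -> 'M_(2 ^ n))
    (a b : MC2) : MC2 :=
  let n := maxn (tag (repr a)) (tag (repr b)) in
  MC2_in (op n (stage n (repr a)) (stage n (repr b))).

Definition MC2_add := MC2_op2 (fun=> +%R).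
Definition MC2_mul := MC2_op2 (fun=> mulmx).
Definition MC2_opp (a : MC2) : MC2 := MC2_in (- tagged (repr a)).
Definition MC2_zero : MC2 := MC2_in (0 : 'M[R]_(2 ^ 0)).
Definition MC2_one : MC2 := MC2_in (1%:M : 'M[R]_(2 ^ 0)).

Lemma MC2_in_up k n (A : 'M[R]_(2 ^ k)) : (k <= n)%N ->
  MC2_in (stage n (lvl A)) = MC2_in A.
Proof. by move=> kn; rewrite MC2_in_stage. Qed.

Lemma stage_repr n k (A : 'M[R]_(2 ^ k)) :
  (k <= n)%N -> (tag (repr (MC2_in A)) <= n)%N ->
  stage n (repr (MC2_in A)) = stage n (lvl A).
Proof. by move=> kn rn; apply: MC2_in_inj; rewrite !MC2_in_stage ?reprK. Qed.

Lemma MC2_in_op2 (op : forall n, 'M[R]_(2 ^ n) -> 'M_(2 ^ n) -> 'M_(2 ^ n)) :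
  (forall n, {morph @dblmx n : A B / op n A B >-> op n.+1 A B}) ->
  forall k, {morph @MC2_in k : A B / op k A B >-> MC2_op2 op A B}.
Proof.
move=> opD.
have opS m n x y : (tag x <= m)%N -> (tag y <= m)%N -> (m <= n)%N ->
    MC2_in (op n (stage n x) (stage n y)) = MC2_in (op m (stage m x) (stage m y)).
  move=> xm ym; elim: n => [|n IHn]; first by rewrite leqn0 => /eqP->.
  rewrite leq_eqVlt => /predU1P[<- //|]; rewrite ltnS => mn.
  by rewrite !stageS ?(leq_trans _ mn) // -opD MC2_in_dbl IHn.
move=> k A B; rewrite /MC2_op2; set m := maxn _ _.
have [Am Bm] : (tag (repr (MC2_in A)) <= m)%N /\ (tag (repr (MC2_in B)) <= m)%N.
  by rewrite leq_maxl leq_maxr.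
pose n := maxn m k.
have [mn kn] : (m <= n)%N /\ (k <= n)%N by rewrite leq_maxl leq_maxr.
rewrite -(opS m n _ _ Am Bm mn) !stage_repr ?kn ?(leq_trans Am) ?(leq_trans Bm) //.
by rewrite (opS k n) // !stage_lvl.
Qed.

Fact MC2_in_add k : {morph @MC2_in k : A B / A + B >-> MC2_add A B}.
Proof. exact: (MC2_in_op2 dblmxD). Qed.

Fact MC2_in_mul k : {morph @MC2_in k : A B / A *m B >-> MC2_mul A B}.
Proof. exact: (MC2_in_op2 dblmxM). Qed.

Fact MC2_in_zero k : MC2_in (0 : 'M_(2 ^ k)) = MC2_zero.
Proof. by elim: k => // k IHk; rewrite -dblmx0 MC2_in_dbl. Qed.

Fact MC2_in_one k : MC2_in (1%:M : 'M_(2 ^ k)) = MC2_one.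
Proof. by elim: k => // k IHk; rewrite -dblmx1 MC2_in_dbl. Qed.

Fact MC2_common3 (a b c : MC2) : exists n (A B C : 'M[R]_(2 ^ n)),
  [/\ a = MC2_in A, b = MC2_in B & c = MC2_in C].
Proof.
pose n := maxn (tag (repr a)) (maxn (tag (repr b)) (tag (repr c))).
have [an bn cn] :
    [/\ tag (repr a) <= n, tag (repr b) <= n & tag (repr c) <= n]%N.
  by rewrite /n !leq_max !leqnn !orbT.
have [[A ->] [B ->] [C ->]] := And3 (MC2_in_surj an) (MC2_in_surj bn) (MC2_in_surj cn).
by exists n, A, B, C.
Qed.

Fact MC2_addA : associative MC2_add.
Proof.
move=> a b c; have [n [A [B [C [-> -> ->]]]]] := MC2_common3 a b c.
by rewrite -!MC2_in_add addrA.
Qed.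

Fact MC2_addC : commutative MC2_add.
Proof.
move=> a b; have [n [A [B [_ [-> -> _]]]]] := MC2_common3 a b a.
by rewrite -!MC2_in_add addrC.
Qed.

Fact MC2_add0 : left_id MC2_zero MC2_add.
Proof.
move=> a; have [n [A [_ [_ [-> _ _]]]]] := MC2_common3 a a a.
by rewrite -(MC2_in_zero n) -MC2_in_add add0r.
Qed.

Fact MC2_addN : left_inverse MC2_zero MC2_opp MC2_add.
Proof.
move=> a; have -> : MC2_add (MC2_opp a) a =
    MC2_add (MC2_opp a) (MC2_in (tagged (repr a))).
  by congr MC2_add; rewrite -[LHS]reprK /MC2_in; case: (repr a).
by rewrite -MC2_in_add addNr MC2_in_zero.
Qed.

HB.instance Definition _ := GRing.isZmodule.Build MC2 MC2_addA MC2_addC MC2_add0 MC2_addN.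

Fact MC2_mulA : associative MC2_mul.
Proof.
move=> a b c; have [n [A [B [C [-> -> ->]]]]] := MC2_common3 a b c.
by rewrite -!MC2_in_mul mulmxA.
Qed.

Fact MC2_mul1 : left_id MC2_one MC2_mul.
Proof.
move=> a; have [n [A [_ [_ [-> _ _]]]]] := MC2_common3 a a a.
by rewrite -(MC2_in_one n) -MC2_in_mul mul1mx.
Qed.

Fact MC2_mulr1 : right_id MC2_one MC2_mul.
Proof.
move=> a; have [n [A [_ [_ [-> _ _]]]]] := MC2_common3 a a a.
by rewrite -(MC2_in_one n) -MC2_in_mul mulmx1.
Qed.

Fact MC2_mulDl : left_distributive MC2_mul +%R.
Proof.
move=> a b c; have [n [A [B [C [-> -> ->]]]]] := MC2_common3 a b c.
by rewrite -[_ + _]MC2_in_add -!MC2_in_mul -[RHS]MC2_in_add mulmxDl.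
Qed.

Fact MC2_mulDr : right_distributive MC2_mul +%R.
Proof.
move=> a b c; have [n [A [B [C [-> -> ->]]]]] := MC2_common3 a b c.
by rewrite -[_ + _]MC2_in_add -!MC2_in_mul -[RHS]MC2_in_add mulmxDr.
Qed.

HB.instance Definition _ :=
  GRing.Zmodule_isPzRing.Build MC2 MC2_mulA MC2_mul1 MC2_mulr1 MC2_mulDl MC2_mulDr.

Fact MC2_in_is_zmod_morphism k : zmod_morphism (@MC2_in k).
Proof.
move=> A B; apply: (addIr (MC2_in B)).
by rewrite subrK -[LHS]MC2_in_add subrK.
Qed.

Fact MC2_in_is_monoid_morphism k : monoid_morphism (@MC2_in k).
Proof. by split; [exact: MC2_in_one | exact: MC2_in_mul]. Qed.

HB.instance Definition _ k :=
  GRing.isZmodMorphism.Build _ _ (@MC2_in k) (@MC2_in_is_zmod_morphism k).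
HB.instance Definition _ k :=
  GRing.isMonoidMorphism.Build _ _ (@MC2_in k) (@MC2_in_is_monoid_morphism k).

(* MC_2(R) has the universal property of the direct limit. *)
Lemma MC2_universal (S : pzRingType) (f : forall k, {rmorphism 'M[R]_(2 ^ k) -> S}) :
  (forall k (A : 'M[R]_(2 ^ k)), f k.+1 (dblmx A) = f k A) ->
  exists! g : MC2 -> S, exists h : {rmorphism MC2 -> S},
    h =1 g /\ forall k (A : 'M[R]_(2 ^ k)), g (MC2_in A) = f k A.
Proof.
move=> fD; pose g (a : MC2) : S := f _ (tagged (repr a)).
have fS n x : (tag x <= n)%N -> f n (stage n x) = f _ (tagged x).
  have stage_tag : stage (tag x) x = tagged x by case: x => k A; exact: stage_lvl.
  have f_tag m : tag x = m -> f m (stage m x) = f _ (tagged x).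
    by move=> <-; rewrite stage_tag.
  elim: n => [|n IHn]; first by rewrite leqn0 => /eqP/f_tag.
  rewrite leq_eqVlt => /predU1P[/f_tag //|]; rewrite ltnS => xn.
  by rewrite stageS // fD IHn.
have gE k (A : 'M[R]_(2 ^ k)) : g (MC2_in A) = f k A.
  pose n := maxn k (tag (repr (MC2_in A))).
  rewrite /g -(fS n) ?leq_maxr // stage_repr ?leq_maxl ?leq_maxr //.
  by rewrite fS ?leq_maxl.
have gB : zmod_morphism g.
  move=> a b; have [n [A [B [_ [-> -> _]]]]] := MC2_common3 a b a.
  by rewrite -raddfB !gE raddfB.
have gM : monoid_morphism g.
  split=> [|a b]; first by rewrite -[1](MC2_in_one 0) gE rmorph1.
  have [n [A [B [_ [-> -> _]]]]] := MC2_common3 a b a.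
  by rewrite -[_ * _]MC2_in_mul !gE -[_ *m _]/(A * B) rmorphM.
pose gm := GRing.isZmodMorphism.Build _ _ g gB.
pose gr := GRing.isMonoidMorphism.Build _ _ g gM.
pose h : {rmorphism MC2 -> S} := HB.pack g gm gr.
exists g; split=> [|g' [_ [_ g'E]]]; first by exists h.
apply/funext => a; have [n [A [_ [_ [-> _ _]]]]] := MC2_common3 a a a.
by rewrite gE g'E.
Qed.

End MatricialClosure.

Definition simple_module (S : pzRingType) (V : lmodType S) : Prop :=
  (exists v : V, v != 0) /\
  forall N : set V, submod_closed (mem N) -> N = [set 0]%classic \/ N = setT.

Definition isomorphic_modules (S : pzRingType) (V W : lmodType S) : Prop :=
  exists f : {linear V -> W}, bijective f.

(* Main.v *)
Require Import Defs.
From HB Require Import structures.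
From mathcomp Require Import all_boot all_algebra zify.
From mathcomp Require Import boolp classical_sets functions cardinality.

(** Index the rows and columns of [M_{2^k}(K)] by binary words of length [k], so
    that [MC_2(K)] acts on functions on infinite binary sequences by replacing
    prefixes. The functions supported on one class of sequences modulo
    "eventually equal" form a simple module. The matrix units [e_{uu}], with [u]
    running over the prefixes of [x], cut out the line of functions supported at
    [x], so an isomorphism between the modules of two classes forces the classes
    to coincide. Finally, [2^aleph_0] classes are obtained by writing every bit
    of [s] infinitely often. *)

Set Implicit Arguments.
Unset Strict Implicit.
Unset Printing Implicit Defensive.

Import GRing.Theory.

(** * Prefixes of binary sequences *)

Section Prefix.
Implicit Types (y z s : nat -> bool) (i j k : nat).

(* Least significant bit first: [dblmx] adds the most significant bit to an index. *)
Definition prefix_nat k y := \sum_(j < k) y j * 2 ^ j.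

Definition set_prefix k i y : nat -> bool :=
  fun j => if j < k then odd (i %/ 2 ^ j) else y j.

Lemma prefix_natS k y : prefix_nat k.+1 y = prefix_nat k y + y k * 2 ^ k.
Proof. by rewrite /prefix_nat big_ord_recr. Qed.

Lemma prefix_nat_lt k y : prefix_nat k y < 2 ^ k.
Proof.
elim: k => [|k IHk]; first by rewrite /prefix_nat big_ord0.
by rewrite prefix_natS -exp2S; case: (y k); lia.
Qed.

Definition prefix_ord k y : 'I_(2 ^ k) := Ordinal (prefix_nat_lt k y).

Lemma eq_prefix_nat k y z :
  (forall j, j < k -> y j = z j) -> prefix_nat k y = prefix_nat k z.
Proof. by move=> yz; apply: eq_bigr => j _; rewrite yz. Qed.

Lemma odd_prefix_nat k y j : j < k -> odd (prefix_nat k y %/ 2 ^ j) = y j.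
Proof.
elim: k => // k IHk; rewrite prefix_natS ltnS leq_eqVlt => /predU1P[->|jk].
  by rewrite addnC divnMDl ?expn_gt0 // divn_small ?prefix_nat_lt //; case: (y k).
(* Since [j < k], dividing by [2 ^ j] turns the top bit into [y k * 2 ^ (k - j)], which is even. *)
rewrite addnC -[in 2 ^ k](subnK (ltnW jk)) expnD mulnA divnMDl ?expn_gt0 // oddD IHk //.
by rewrite oddM oddX subn_eq0 leqNgt jk andbF addFb.
Qed.

Lemma prefix_nat_bits k i y : prefix_nat k (set_prefix k i y) = i %% 2 ^ k.
Proof.
elim: k => [|k IHk]; first by rewrite /prefix_nat big_ord0 modn1.
rewrite prefix_natS (@eq_prefix_nat _ _ (set_prefix k i y)) => [|j jk]; last first.
  by rewrite /set_prefix jk ltnS ltnW.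
rewrite IHk /set_prefix ltnSn -modn2 [in RHS](divn_eq i (2 ^ k)).
rewrite [in RHS](divn_eq (i %/ 2 ^ k) 2) mulnDl -mulnA -expnS -addnA modnMDl.
rewrite [RHS]modn_small 1?addnC // -exp2S.
have ik : i %% 2 ^ k < 2 ^ k by rewrite ltn_pmod ?expn_gt0.
by rewrite modn2; case: odd; lia.
Qed.

Lemma prefix_ord_set k (i : 'I_(2 ^ k)) y : prefix_ord k (set_prefix k i y) = i.
Proof. by apply: val_inj; rewrite /= prefix_nat_bits modn_small. Qed.

Lemma set_prefix_set k i j y :
  set_prefix k i (set_prefix k j y) = set_prefix k i y.
Proof. by apply/funext => l; rewrite /set_prefix; case: (l < k). Qed.

Lemma set_prefix_nat k y z :
  (forall j, k <= j -> z j = y j) -> set_prefix k (prefix_nat k y) z = y.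
Proof.
move=> zy; apply/funext => j; rewrite /set_prefix.
by case: ltnP => [/odd_prefix_nat|/zy].
Qed.

Lemma set_prefix_ge k i j y : k <= j -> set_prefix k i y j = y j.
Proof. by rewrite /set_prefix ltnNge => ->. Qed.

(** Serves to read the indices of a doubled matrix: [b] selects the diagonal block and [i] the
    position inside it. *)
Lemma set_prefixS k (i : nat) (b : bool) y : i < 2 ^ k ->
  set_prefix k.+1 (b * 2 ^ k + i) y =
  set_prefix k i (fun j => if j == k then b else y j).
Proof.
move=> ik; have e : b * 2 ^ k + i = prefix_nat k.+1
    (set_prefix k i (fun j => if j == k then b else y j)).
  by rewrite prefix_natS prefix_nat_bits modn_small // set_prefix_ge // eqxx addnC.
rewrite e set_prefix_nat // => j kj.
by rewrite set_prefix_ge ?gtn_eqF // ltnW.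
Qed.

Lemma prefix_nat_inj y z : (forall k, prefix_nat k y = prefix_nat k z) -> y = z.
Proof.
move=> yz; apply/funext => j.
by rewrite -(odd_prefix_nat y (ltnSn j)) yz odd_prefix_nat.
Qed.

End Prefix.

Local Open Scope ring_scope.

(** * The action on functions of binary sequences *)

Section Action.
Variable R : pzRingType.

Definition seqfun := (nat -> bool) -> R.
HB.instance Definition _ := GRing.Zmodule.on seqfun.

Implicit Types (f g : seqfun) (y : nat -> bool).

(** For each fixed tail beyond [k], the values of [f] at the [2 ^ k] sequences with this tail form a
    column vector, which [A] multiplies. *)
Definition mx_act k (A : 'M[R]_(2 ^ k)) f : seqfun :=
  fun y => \sum_(i < 2 ^ k) A (prefix_ord k y) i * f (set_prefix k i y).

(** This makes the actions of the matrix rings glue along the direct limit. Bit [k] of [y] selects a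
    diagonal block, and the zero blocks kill the terms in which that bit is flipped. *)
Lemma mx_act_dbl k (A : 'M[R]_(2 ^ k)) f : mx_act (dblmx A) f = mx_act A f.
Proof.
apply/funext => y; rewrite /mx_act.
rewrite (reindex (cast_ord (exp2S k))) /=; last first.
  by exists (cast_ord (esym (exp2S k))) => i _; rewrite ?cast_ordK ?cast_ordKV.
rewrite big_split_ord /=.
have dblE (i : 'I_(2 ^ k + 2 ^ k)) : dblmx A (prefix_ord k.+1 y) (cast_ord (exp2S k) i) =
    block_mx A 0 0 A
      (if y k then rshift _ (prefix_ord k y) else lshift _ (prefix_ord k y)) i.
  rewrite /dblmx castmxE /= cast_ordK; congr (block_mx A 0 0 A _ i).
  by apply: val_inj; rewrite /= prefix_natS; case: (y k) => /=; lia.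
have yE : (fun j => if j == k then y k else y j) = y.
  by apply/funext => j; case: eqP => // ->.
case yk: (y k).
- rewrite big1 ?add0r => [|i _]; last first.
    by rewrite dblE yk block_mxEdl mxE mul0r.
  apply: eq_bigr => i _; rewrite dblE yk block_mxEdr /=.
  by have /= := @set_prefixS k i true y (ltn_ord i); rewrite -[in RHS]yk yE mul1n => ->.
- rewrite [X in _ + X]big1 ?addr0 => [|i _]; last first.
    by rewrite dblE yk block_mxEur mxE mul0r.
  apply: eq_bigr => i _; rewrite dblE yk block_mxEul /=.
  by have /= := @set_prefixS k i false y (ltn_ord i); rewrite -[in RHS]yk yE mul0n => ->.
Qed.

Lemma mx_act_stage n (x : MC2_pre R) f :
  (tag x <= n)%N -> mx_act (stage n x) f = mx_act (tagged x) f.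
Proof.
move=> xn; rewrite -(subnK xn); elim: (n - tag x)%N => [|m IHm].
  by case: x {xn} => k A; rewrite add0n stage_lvl.
by rewrite addSn stageS ?leq_addl // mx_act_dbl.
Qed.

Definition act (a : MC2 R) f : seqfun := mx_act (tagged (repr a)) f.

Lemma act_in k (A : 'M[R]_(2 ^ k)) f : act (MC2_in A) f = mx_act A f.
Proof.
pose n := maxn k (tag (repr (MC2_in A))).
rewrite /act -(@mx_act_stage n) ?leq_maxr // stage_repr ?leq_maxl ?leq_maxr //.
by rewrite mx_act_stage ?leq_maxl.
Qed.

Lemma mx_actM k (A B : 'M[R]_(2 ^ k)) f :
  mx_act (A *m B) f = mx_act A (mx_act B f).
Proof.
apply/funext => y; rewrite /mx_act.
under eq_bigr do rewrite mxE mulr_suml.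
rewrite exchange_big /=; apply: eq_bigr => i _; rewrite mulr_sumr.
apply: eq_bigr => j _; rewrite mulrA prefix_ord_set.
by rewrite set_prefix_set.
Qed.

Fact actA a b f : act a (act b f) = act (a * b) f.
Proof.
have [n [A [B [_ [-> -> _]]]]] := MC2_common3 a b a.
by rewrite -[_ * _]MC2_in_mul !act_in mx_actM.
Qed.

Fact act1 : left_id 1 act.
Proof.
move=> f; rewrite -[1](MC2_in_one _ 0) act_in; apply/funext => y.
rewrite /mx_act (bigD1 (prefix_ord 0 y)) //= big1 => [|i /negPf iy]; last first.
  by rewrite mxE eq_sym iy mul0r.
by rewrite mxE eqxx mul1r addr0 set_prefix_nat.
Qed.

Fact actDr : right_distributive act +%R.
Proof.
move=> a f g; apply/funext => y; rewrite /act /mx_act -[RHS]big_split /=.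
by apply: eq_bigr => i _; rewrite -mulrDr.
Qed.

Fact actDl f : {morph act^~ f : a b / a + b}.
Proof.
move=> a b; have [n [A [B [_ [-> -> _]]]]] := MC2_common3 a b a.
rewrite -[_ + _]MC2_in_add !act_in; apply/funext => y.
rewrite /mx_act -[RHS]big_split /=.
by apply: eq_bigr => i _; rewrite mxE mulrDl.
Qed.

HB.instance Definition _ :=
  GRing.Zmodule_isLmodule.Build (MC2 R) seqfun actA act1 actDr actDl.

Lemma scale_seqfunE k (A : 'M[R]_(2 ^ k)) f y :
  (MC2_in A *: f) y =
  \sum_(i < 2 ^ k) A (prefix_ord k y) i * f (set_prefix k i y).
Proof. by rewrite -[_ *: _]/(act _ _) act_in. Qed.

End Action.

(** * The modules attached to tail classes *)

Section TailModule.
Variable R : pzRingType.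
Variable s : nat -> bool.

(** One [k] serves the whole support, which is therefore finite: each element is a column vector at
    some finite level. *)
Definition tail_supported : {pred seqfun R} := fun f =>
  `[< exists k, forall y, f y != 0 -> forall j, (k <= j)%N -> y j = s j >].

Fact tail_supported_closed : submod_closed tail_supported.
Proof.
split=> [|a f g /asboolP[k fk] /asboolP[l gl]].
  by apply/asboolP; exists 0 => y; rewrite eqxx.
have [n [A [_ [_ [-> _ _]]]]] := MC2_common3 a a a.
(* Beyond [n] the matrix changes no bit of a sequence; beyond [k] and [l] all points of the two
   supports agree with [s]. *)
apply/asboolP; exists (maxn n (maxn k l)) => y afg j.
rewrite !geq_max => /and3P[nj kj lj]; apply: contrapT => yj; move/negP: afg; apply.
rewrite -[(_ + _) y]/((MC2_in A *: f) y + g y) scale_seqfunE big1 => [|i _].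
  by rewrite add0r; apply/negPn/negP => /gl/(_ _ lj).
rewrite (_ : f _ = 0) ?mulr0 //; apply/eqP/negPn/negP => /fk/(_ _ kj).
by rewrite set_prefix_ge.
Qed.

HB.instance Definition _ :=
  GRing.isSubmodClosed.Build (MC2 R) (seqfun R) tail_supported tail_supported_closed.

Definition tail_module := {f : seqfun R | tail_supported f}.
HB.instance Definition _ := SubChoice.on tail_module.
HB.instance Definition _ := [SubChoice_isSubLmodule of tail_module by <:].

End TailModule.

(** * Simplicity and isomorphism of the tail modules *)

Section Simplicity.
Variable K : fieldType.
Implicit Types (s t x : nat -> bool).

Definition dirac x : seqfun K := fun y => if `[< y = x >] then 1 else 0.

Lemma dirac_supported s : tail_supported s (dirac s).
Proof.
apply/asboolP; exists 0 => y.
by rewrite /dirac; case: asboolP => [->|]; rewrite ?eqxx.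
Qed.

Definition tail_dirac s : tail_module K s := exist _ (dirac s) (dirac_supported s).

Lemma tail_dirac_neq0 s : tail_dirac s != 0.
Proof.
apply/eqP => /(congr1 val)/(congr1 (@^~ s))/=.
by rewrite /dirac asboolT // => /eqP; rewrite oner_eq0.
Qed.

Lemma tail_module_neq0 s (f : tail_module K s) :
  f != 0 -> exists y, val f y != 0.
Proof.
move=> /eqP f0; apply: contrapT => fN; apply: f0; apply: val_inj.
by apply/funext => y; apply/eqP/negPn/negP => fy; apply: fN; exists y.
Qed.

(** At a common level [n] both functions are column vectors over the tail of [s]. A matrix whose
    only nonzero column sits at a nonzero entry of [f] can send [f] to any vector. *)
Lemma tail_module_cyclic s (f g : tail_module K s) :
  f != 0 -> exists a : MC2 K, g = a *: f.
Proof.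
move=> /tail_module_neq0[y fy].
have [/asboolP[k fk] /asboolP[l gl]] := (valP f, valP g).
pose n := maxn k l; have [kn ln] : (k <= n /\ l <= n)%N by rewrite leq_maxl leq_maxr.
pose A : 'M[K]_(2 ^ n) := \matrix_(i, j)
  if j == prefix_ord n y then val g (set_prefix n i s) / val f y else 0.
exists (MC2_in A); apply: val_inj; apply/funext => z.
rewrite linearZ /= scale_seqfunE (bigD1 (prefix_ord n y)) //= big1 => [|i /negPf iy].
  rewrite addr0 mxE eqxx.
  (* If [z] has the tail of [s], then giving it the prefix of [y] yields [y], and [val f y] cancels;
     otherwise both sides vanish. *)
  have [zs|zs] := pselect (forall j, (n <= j)%N -> z j = s j).
    rewrite !set_prefix_nat ?divfK // => j nj; first by rewrite zs.
    by rewrite zs // (fk _ fy) ?(leq_trans kn).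
  rewrite [val f (set_prefix _ _ _)](_ : _ = 0) ?mulr0.
    apply/eqP/negPn/negP => /gl gz; apply: zs => j nj.
    by rewrite gz // (leq_trans ln).
  apply/eqP/negPn/negP => /fk fz; apply: zs => j nj.
  by rewrite -fz ?(leq_trans kn) // set_prefix_ge.
by rewrite mxE iy mul0r.
Qed.

Lemma tail_module_simple s : simple_module (tail_module K s).
Proof.
split=> [|N [N0 NL]]; first by exists (tail_dirac s); exact: tail_dirac_neq0.
have [[f [Nf f0]]|NN] := pselect (exists f, N f /\ f != 0).
  right; apply/seteqP; split=> // g _; have [a ->] := tail_module_cyclic g f0.
  have := NL a f 0 (mem_set Nf) N0.
  by rewrite addr0 => /set_mem.
left; apply/seteqP; split=> [f Nf|f ->]; last exact: set_mem.
by apply/eqP/negPn/negP => f0; apply: NN; exists f.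
Qed.

(** A diagonal matrix unit acts as restriction to the cylinder of sequences that share their first
    [k] bits with [x]. *)
Lemma scale_diag_delta k x (f : seqfun K) y :
  (MC2_in (delta_mx (prefix_ord k x) (prefix_ord k x)) *: f) y =
  if prefix_ord k y == prefix_ord k x then f y else 0.
Proof.
rewrite scale_seqfunE (bigD1 (prefix_ord k y)) //= big1 => [|i /negPf iy].
  by rewrite addr0 mxE andbb set_prefix_nat //; case: ifP; rewrite ?mul1r ?mul0r.
rewrite mxE; case: eqP => [<-|]; rewrite ?mul0r //.
by rewrite iy mul0r.
Qed.

Lemma isomorphic_tail s t : isomorphic_modules (tail_module K s) (tail_module K t) ->
  exists k, forall j, (k <= j)%N -> s j = t j.
Proof.
move=> [h /bij_inj h_inj]; pose w := h (tail_dirac s).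
have [y wy] : exists y, val w y != 0.
  by apply: tail_module_neq0; rewrite -(linear0 h) (inj_eq h_inj) tail_dirac_neq0.
have ys : y = s.
  (* By linearity [w] is fixed by every diagonal unit that fixes the Dirac function at [s], so it
     vanishes outside each cylinder around [s]. *)
  apply: prefix_nat_inj => k.
  pose E := delta_mx (prefix_ord k s) (prefix_ord k s) : 'M[K]_(2 ^ k).
  have ed : MC2_in E *: tail_dirac s = tail_dirac s.
    apply: val_inj; apply/funext => z; rewrite linearZ /= scale_diag_delta.
    by rewrite /dirac; case: asboolP => [->|_]; rewrite ?eqxx ?if_same.
  have ew : MC2_in E *: w = w by rewrite /w -linearZ /= ed.
  move: wy; rewrite -ew linearZ /= scale_diag_delta.
  by case: (prefix_ord k y =P _) => [[]|_]; rewrite ?eqxx.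
(* Now [s] itself lies in the support of [w], whose points all end like [t]. *)
have /asboolP[k wk] := valP w.
by exists k => j kj; rewrite -ys (wk _ wy).
Qed.

End Simplicity.

(* Each value [s i] is taken infinitely often, at the odd multiples of [2 ^ i]. *)
Definition spread (s : nat -> bool) : nat -> bool := fun n => s (logn 2 n).

Lemma spread_eventually_inj s t k :
  (forall j, (k <= j)%N -> spread s j = spread t j) -> s = t.
Proof.
move=> st; apply/funext => i.
(* The odd factor [k.*2.+1] leaves the 2-adic valuation equal to [i] and pushes the index past
   [k]. *)
have e : logn 2 (2 ^ i * k.*2.+1) = i.
  rewrite lognM ?expn_gt0 // pfactorK // logn_coprime ?addn0 //.
  by rewrite coprime2n /= odd_double.
have := st (2 ^ i * k.*2.+1)%N; rewrite /spread e; apply.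
by have := expn_gt0 2 i; nia.
Qed.

(* The index type nat -> bool has cardinality 2^aleph_0. *)
Theorem mainTheorem10 (K : fieldType) (hK : countable (@setT K)) :
  exists V : (nat -> bool) -> lmodType (MC2 K),
    (forall s, simple_module (V s)) /\
    (forall s t, s <> t -> ~ isomorphic_modules (V s) (V t)).
Proof.
exists (fun s => tail_module K (spread s)); split=> [s|s t st].
  exact: tail_module_simple.
by move=> /isomorphic_tail[k /spread_eventually_inj].
Qed.
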